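(* Let $n\ge3$, $m\ge2$. The quantum geometric $R$-matrices $R_1^\epsilon,\dots,R_{m-1}^\epsilon:\mathcal{Q}_\epsilon\to\mathcal{Q}_\epsilon$ satisfy $R_j^\epsilon R_{j+1}^\epsilon R_j^\epsilon=R_{j+1}^\epsilon R_j^\epsilon R_{j+1}^\epsilon$ for $1\le j\le m-2$ and $(R_j^\epsilon)^2=\mathrm{id}$ for $1\le j\le m-1$. Furthermore $R_i^\epsilon R_j^\epsilon=R_j^\epsilon R_i^\epsilon$ whenever $|i-j|>1$. Thus the $R_j^\epsilon$ generate an action of the symmetric group $\mathfrak{S}_m$ on $\mathcal{Q}_\epsilon$.
   Context: Second indices are taken in $\mathbb{Z}/n\mathbb{Z}$, and $\epsilon$ is a central indeterminate. For $k\in\mathbb{Z}/n\mathbb{Z}$ let $S_k$ be the set of $q_{j,i}$ with $i+j\equiv1+k\pmod n$. $\mathcal{Q}_\epsilon=\mathbb{Q}_\epsilon\langle\mathbf{q}_1,\dots,\mathbf{q}_m\rangle$, $\mathbf{q}_j=(q_{j,i})_{i}$, is the skew field of fractions of the quantum torus over $\mathbb{Z}[\epsilon,\epsilon^{-1}]$ generated by the $q_{j,i}^{\pm1}$ ($1\le j\le m$, $i\in\mathbb{Z}/n\mathbb{Z}$) with relations $$q_{j,i}q_{j',i'}=\begin{cases}\epsilon\,q_{j',i'}q_{j,i}&q_{j,i}\in S_{k+1},\ q_{j',i'}\in S_k,\ j\le j',\\ \epsilon^{-1}q_{j',i'}q_{j,i}&q_{j,i}\in S_{k+1},\ q_{j',i'}\in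 S_k,\ j>j',\\ \epsilon^{-2}q_{j',i'}q_{j,i}&q_{j,i},q_{j',i'}\in S_k,\ j<j',\\ \epsilon^{2}q_{j',i'}q_{j,i}&q_{j,i},q_{j',i'}\in S_k,\ j>j',\\ q_{j',i'}q_{j,i}&\text{if neither } (q_{j,i},q_{j',i'}) \text{ nor } (q_{j',i'},q_{j,i}) \text{ is covered by the previous cases.}\end{cases}$$ Quantum geometric $R$-matrix: for $1\le j\le m-1$ write $p_i=q_{j,i}$, $q_i=q_{j+1,i}$, and $$\kappa_i^\epsilon=\sum_{h=0}^{n-1}p_{i-1}p_{i-2}\cdots p_{i-h}\,q_{i-h-2}q_{i-h-3}\cdots q_{i-n}\qquad(\text{factors in this order}).$$ $R_j^\epsilon:\mathcal{Q}_\epsilon\to\mathcal{Q}_\epsilon$ is the morphism of skew fields with $$R_j^\epsilon(p_i)=(\kappa_i^\epsilon)^{-1}q_i\,\kappa_{i+1}^\epsilon,\qquad R_j^\epsilon(q_i)=(\kappa_{i+1}^\epsilon)^{-1}p_i\,\kappa_i^\epsilon,$$ fixing $\epsilon$ and all $q_{j',i}$ with $j'\ne j,j+1$ (that this defines a morphism of skew fields is a separate result of the paper). Products denote composition. *)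

(* Defs.v *)
From HB Require Import structures.
From mathcomp Require Import all_boot all_order all_algebra all_fingroup.

Set Implicit Arguments.
Unset Strict Implicit.
Unset Printing Implicit Defensive.

Import GRing.Theory.
Local Open Scope ring_scope.

(* The first index j = 1, ..., m is encoded as an ordinal 'I_m, so that
   j : 'I_m stands for the index j.+1; the second index lives in 'Z_n, which
   is Z/nZ since n >= 3 is assumed in the theorem. *)
Definition inS (m n : nat) (k : 'Z_n) (x : 'I_m * 'Z_n) : bool :=
  x.2 + (x.1.+1)%:R == 1 + k.

(* The pairs of generators covered by one of the four noncommuting cases. *)
Definition covered (m n : nat) (x y : 'I_m * 'Z_n) : bool :=
  [exists k : 'Z_n, inS (k + 1) x && inS k y
                    || [&& inS k x, inS k y & x.1 != y.1]].

Record qtorus_relations (m n : nat) (A : unitRingType)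
    (eps : A) (q : 'I_m -> 'Z_n -> A) : Prop := QTorusRelations {
  eps_unit : eps \is a GRing.unit;
  eps_central : forall a : A, eps * a = a * eps;
  gen_unit : forall j i, q j i \is a GRing.unit;
  rel_adj_le : forall k j i j' i', inS (k + 1) (j, i) -> inS k (j', i') ->
    (j <= j')%N -> q j i * q j' i' = eps * q j' i' * q j i;
  rel_adj_gt : forall k j i j' i', inS (k + 1) (j, i) -> inS k (j', i') ->
    (j > j')%N -> q j i * q j' i' = eps^-1 * q j' i' * q j i;
  rel_same_lt : forall k j i j' i', inS k (j, i) -> inS k (j', i') ->
    (j < j')%N -> q j i * q j' i' = eps ^- 2 * q j' i' * q j i;
  rel_same_gt : forall k j i j' i', inS k (j, i) -> inS k (j', i') ->
    (j > j')%N -> q j i * q j' i' = eps ^+ 2 * q j' i' * q j i;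
  rel_comm : forall j i j' i',
    ~~ covered (j, i) (j', i') -> ~~ covered (j', i') (j, i) ->
    q j i * q j' i' = q j' i' * q j i }.

(* The ring presented by these generators and relations: a ring with a central
   unit is the same thing as a Z[eps, eps^-1]-algebra, and the presentation is
   expressed by its universal property. *)
Definition is_qtorus (m n : nat) (A : unitRingType)
    (eps : A) (q : 'I_m -> 'Z_n -> A) : Prop :=
  qtorus_relations eps q /\
  forall (B : unitRingType) (eps' : B) (q' : 'I_m -> 'Z_n -> B),
    qtorus_relations eps' q' ->
    exists f : {rmorphism A -> B},
      [/\ f eps = eps',
          forall j i, f (q j i) = q' j i
        & forall g : {rmorphism A -> B},
            g eps = eps' -> (forall j i, g (q j i) = q' j i) -> g =1 f].

Definition is_skew_field (K : unitRingType) : Prop :=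
  forall x : K, x != 0 -> x \is a GRing.unit.

Definition is_skew_fraction_field (A K : unitRingType)
    (iota : {rmorphism A -> K}) : Prop :=
  [/\ is_skew_field K, injective iota
    & forall x : K, exists a b : A, b != 0 /\ x = iota a * (iota b)^-1].

(* K, with its elements eps and q j i, is the skew field Q_eps. *)
Definition is_qskew_field (m n : nat) (K : unitRingType)
    (eps : K) (q : 'I_m -> 'Z_n -> K) : Prop :=
  exists (A : unitRingType) (epsA : A) (qA : 'I_m -> 'Z_n -> A)
         (iota : {rmorphism A -> K}),
    [/\ is_qtorus epsA qA, is_skew_fraction_field iota,
        iota epsA = eps & forall j i, iota (qA j i) = q j i].

Definition kappa (n : nat) (K : unitRingType) (p q : 'Z_n -> K) (i : 'Z_n) : K :=
  \sum_(0 <= h < n)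
     (\prod_(1 <= a < h.+1) p (i - a%:R)) *
     (\prod_(h.+2 <= a < n.+1) q (i - a%:R)).

(* For j : 'I_m.-1, the two indices j and j + 1 in 'I_m. *)
Definition ord_lo (m : nat) (j : 'I_m.-1) : 'I_m := widen_ord (leq_pred m) j.

Lemma ord_hi_subproof (m : nat) (j : 'I_m.-1) : (j.+1 < m)%N.
Proof. by rewrite -ltn_predRL. Qed.

Definition ord_hi (m : nat) (j : 'I_m.-1) : 'I_m := Ordinal (ord_hi_subproof j).

Definition is_geometric_R (m n : nat) (K : unitRingType)
    (eps : K) (q : 'I_m -> 'Z_n -> K) (j : 'I_m.-1)
    (R : {rmorphism K -> K}) : Prop :=
  let p_ := q (ord_lo j) in
  let q_ := q (ord_hi j) in
  [/\ R eps = eps,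
      forall i, R (p_ i) = (kappa p_ q_ i)^-1 * q_ i * kappa p_ q_ (i + 1),
      forall i, R (q_ i) = (kappa p_ q_ (i + 1))^-1 * p_ i * kappa p_ q_ i
    & forall j' i, j' != ord_lo j -> j' != ord_hi j -> R (q j' i) = q j' i].

(* Main.v *)
From HB Require Import structures.
Require Import Defs.
From mathcomp Require Import all_boot all_order all_algebra all_fingroup.
From mathcomp Require Import zify ring.
Import GRing.Theory.

Set Implicit Arguments.
Unset Strict Implicit.
Unset Printing Implicit Defensive.

Local Open Scope ring_scope.

(** The theorem rests on a rigidity principle: a morphism obtained by composing
    the R-matrices is determined by the permutation underlying the composition.
    Involutivity, the braid relation, commutation at distance at least two and
    the action of the symmetric group are then identities between permutations.

    The principle comes from factorizing difference operators.  A sequence [x]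
    of period [n] acts on sequences by [g |-> g_k x_k - g_(k+1)] (right
    multiplication by [x - S], where [S] is the shift), and the family of
    generators gives the operator [L = (q_1 - S) (q_2 - S) .. (q_m - S)].

    Each R-matrix preserves [L].  With [p = q_j], [q = q_(j+1)] and
    [p' = R p], [q' = R q], this says that [p'_i q'_i = p_i q_i] and
    [p'_(i+1) + q'_i = p_(i+1) + q_i] ([image_mul], [image_add]).  Both follow
    from three identities for kappa: [kappa_left] and [kappa_right] telescope
    to the same difference of full cycle products, and [kappa_qp] says that
    [q_i p_i] commutes with [kappa_i] up to [eps].  The equalities are local,
    so they survive the application of any further morphism, and every
    composition of R-matrices preserves [L].

    The product of a row over a full cycle is central, distinct rows have
    distinct products ([ascprod_central], [ascprod_inj]), and [R_j] exchanges
    the products of rows [j] and [j+1] ([R_ascprod]).  A composition with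
    permutation [s] therefore sends the generators to a factorization of [L]
    whose [k]-th factor has cycle product that of the row [s k].

    Over a skew field such a factorization is unique
    ([factorization_unique]).  The row vector killed by the first factor is
    multiplied by the cycle product of that factor when its index grows by [n],
    while the other factors have no nonzero kernel vector with that multiplier.
    So the first factor is determined by [L] and its cycle product, and one
    concludes by induction.

    Finally, two endomorphisms of the quantum skew field that fix [eps] and
    agree on the generators are equal, by the universal property of the quantum
    torus ([qskew_morph_eq]). *)

(** * Uniqueness of factorizations of periodic difference operators *)

Section Factorization.

Variables (K : unitRingType) (n : nat).
Hypothesis K_skew : is_skew_field K.

(** The operator [x - S] acts on the right of the row vector [g], so that it
    commutes with left multiplication by scalars; this is why quasi-periodicity
    multiplies on the left. *)
Definition diffop (x g : nat -> K) (k : nat) : K := g k * x k - g k.+1.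

(** The first factor is applied first: this is the action of the ordered
    product of the [x j - S], for [j] along [s]. *)
Definition diffops (I : Type) (x : I -> nat -> K) (s : seq I) (g : nat -> K) :=
  foldl (fun h j => diffop (x j) h) g s.

Definition quasiperiodic (c : K) (g : nat -> K) :=
  forall k, g (k + n)%N = c * g k.

Lemma eq_diffop x g h : g =1 h -> diffop x g =1 diffop x h.
Proof. by move=> gh k; rewrite /diffop !gh. Qed.

Lemma eq_diffops (I : Type) (x : I -> nat -> K) s g h :
  g =1 h -> diffops x s g =1 diffops x s h.
Proof. by elim: s g h => //= j s IHs g h gh; apply/IHs/eq_diffop. Qed.

Lemma eq_in_diffops (I : eqType) (x y : I -> nat -> K) s g :
  (forall j, j \in s -> x j =1 y j) -> diffops x s g =1 diffops y s g.
Proof.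
elim: s g => //= j s IHs g xy k.
rewrite IHs => [|i si]; last by apply: xy; rewrite inE si orbT.
by apply: eq_diffops => l; rewrite /diffop xy // mem_head.
Qed.

(** These two families of quantities are the coefficients of the operator
    [(x - S) (x' - S)]. *)
Lemma diffop_pair (x x' y y' : nat -> K) g :
  (forall k, x k * x' k = y k * y' k) ->
  (forall k, x k.+1 + x' k = y k.+1 + y' k) ->
  diffop x' (diffop x g) =1 diffop y' (diffop y g).
Proof.
have e (u v : nat -> K) k : diffop v (diffop u g) k =
    g k * (u k * v k) - g k.+1 * (u k.+1 + v k) + g k.+2.
  rewrite /diffop mulrBl mulrDr !mulrA opprB [_ + g k.+1 * v k]addrC opprD.
  by rewrite -!addrA; do 2!congr (_ + _); rewrite addrC.
by move=> mE aE k; rewrite !e mE aE.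
Qed.

Lemma diffops0 (I : Type) (x : I -> nat -> K) s :
  diffops x s (fun=> 0) =1 (fun=> 0).
Proof.
elim: s => //= j s IHs k; rewrite (eq_diffops _ _ (h := fun=> 0)) ?IHs // => l.
by rewrite /diffop mul0r subr0.
Qed.

Lemma quasiperiodic_diffop c x g :
  quasiperiodic 1 x -> quasiperiodic c g -> quasiperiodic c (diffop x g).
Proof.
by move=> px cg k; rewrite /diffop -addSn !cg px mul1r mulrBr mulrA.
Qed.

Lemma diffop_surj x h : exists g, diffop x g =1 h.
Proof.
exists (fix g k := if k is l.+1 then g l * x l - h l else 0) => k.
by rewrite /diffop opprB addrC subrK.
Qed.

Lemma diffop_kernelE x g : diffop x g =1 (fun=> 0) ->
  forall k, g k = g 0%N * \prod_(0 <= i < k) x i.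
Proof.
move=> xg; elim=> [|k IHk]; first by rewrite big_nil mulr1.
by rewrite big_nat_recr //= mulrA -IHk; apply/esym/subr0_eq/xg.
Qed.

(** A kernel vector [g] of [x - S] satisfies [g n = g 0 * \prod x], and
    quasi-periodicity gives [g n = c * g 0]; with [c] central and different from
    the product, [g 0] vanishes. *)
Lemma diffop_kernel0 c x g :
  (forall a, c * a = a * c) -> \prod_(0 <= i < n) x i != c ->
  quasiperiodic c g -> diffop x g =1 (fun=> 0) -> g =1 (fun=> 0).
Proof.
move=> cC xc cg xg k; rewrite (diffop_kernelE xg).
suff -> : g 0%N = 0 by rewrite mul0r.
rewrite -subr_eq0 in xc; apply: (mulIr (K_skew xc)).
by rewrite mul0r mulrBr -cC -cg add0n -(diffop_kernelE xg) subrr.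
Qed.

(** Quasi-periodicity with multiplier [c] is inherited by the image under each
    factor, so the factors can be removed from the last one to the first. *)
Lemma diffops_kernel0 (I : eqType) (x : I -> nat -> K) c s g :
  (forall a, c * a = a * c) ->
  (forall j, j \in s -> quasiperiodic 1 (x j)) ->
  (forall j, j \in s -> \prod_(0 <= i < n) x j i != c) ->
  quasiperiodic c g -> diffops x s g =1 (fun=> 0) -> g =1 (fun=> 0).
Proof.
move=> cC; elim: s g => //= j s IHs g px xc cg xg.
have [pj xj] := (px j (mem_head _ _), xc j (mem_head _ _)).
apply: (diffop_kernel0 (c := c) (x := x j)) => //; apply: IHs => //.
- by move=> i si; apply: px; rewrite inE si orbT.
- by move=> i si; apply: xc; rewrite inE si orbT.
exact: quasiperiodic_diffop.
Qed.

(** The kernel of the first factor [y j - S] is spanned by the partial products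
    of [y j].  This vector is killed by the other factorization as well, and has
    multiplier [lam j], which the remaining factors do not allow; hence it is
    killed by [x j - S], which forces [x j = y j].  As [x j - S] is surjective,
    the first factors cancel. *)
Lemma factorization_unique (I : eqType) (x y : I -> nat -> K)
    (lam : I -> K) s :
  (forall j, quasiperiodic 1 (x j)) -> (forall j, quasiperiodic 1 (y j)) ->
  (forall j k, y j k \is a GRing.unit) ->
  (forall j a, lam j * a = a * lam j) -> injective lam -> uniq s ->
  (forall j, \prod_(0 <= i < n) x j i = lam j) ->
  (forall j, \prod_(0 <= i < n) y j i = lam j) ->
  (forall g, diffops x s g =1 diffops y s g) ->
  forall j, j \in s -> x j =1 y j.
Proof.
move=> px py uy lamC lamI + xlam ylam.
elim: s => //= j s IHs /andP[js us] xy.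
have xyj : x j =1 y j.
  pose g k := \prod_(0 <= i < k) y j i.
  have g0 : g 0%N = 1 by rewrite /g big_geq.
  have gS k : g k.+1 = g k * y j k by rewrite /g big_nat_recr.
  have yg : diffop (y j) g =1 (fun=> 0) by move=> k; rewrite /diffop gS subrr.
  have cg : quasiperiodic (lam j) g.
    elim=> [|k IHk]; first by rewrite add0n g0 mulr1 -ylam.
    by rewrite addSn !gS IHk py mul1r mulrA.
  have ug k : g k \is a GRing.unit.
    by elim: k => [|k IHk]; [rewrite g0 unitr1 | rewrite gS unitrMl ?uy].
  have xg : diffop (x j) g =1 (fun=> 0).
    apply: (diffops_kernel0 (x := x) (c := lam j) (s := s)) => //.
    - by move=> i si; rewrite xlam; apply: contraNneq js => /lamI <-.
    - exact: quasiperiodic_diffop.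
    by move=> k; rewrite [LHS]xy (eq_diffops _ _ yg) diffops0.
  move=> k; apply: (mulrI (ug k)).
  by rewrite -gS; apply/subr0_eq/xg.
move=> i; rewrite inE => /predU1P[-> //|si]; apply: IHs => // h k.
have [g gh] := diffop_surj (x j) h.
have yh : diffop (y j) g =1 h by move=> l; rewrite -gh /diffop xyj.
by rewrite -(eq_diffops _ _ gh) -[RHS](eq_diffops _ _ yh) [LHS]xy.
Qed.

End Factorization.

(** * Commutation up to powers of a central unit *)

Lemma natZn_eq (n a b : nat) : (1 < n)%N ->
  (a%:R == b%:R :> 'Z_n) = (a == b %[mod n])%N.
Proof. by move=> n1; rewrite -val_eqE /= !val_Zp_nat. Qed.

Section QCommutation.

Variables (A : unitRingType) (eps : A).
Hypothesis eps_u : eps \is a GRing.unit.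
Hypothesis eps_c : forall a : A, eps * a = a * eps.

Definition qcomm (z : int) (a b : A) := a * b = eps ^ z * (b * a).

Lemma epsX_central z a : eps ^ z * a = a * eps ^ z.
Proof. by apply/esym/commrXz; rewrite /GRing.comm eps_c. Qed.

Lemma qcomm_sym z a b : qcomm z a b -> qcomm (- z) b a.
Proof. by rewrite /qcomm => ->; rewrite mulrA -exprzDr // addNr mul1r. Qed.

Lemma qcommM z t a b c : qcomm z a b -> qcomm t a c -> qcomm (z + t) a (b * c).
Proof.
rewrite /qcomm => ab ac.
by rewrite mulrA ab exprzDr // -!mulrA ac (mulrA b) -epsX_central !mulrA.
Qed.

Lemma qcommMl z t a b c : qcomm z a c -> qcomm t b c -> qcomm (z + t) (a * b) c.
Proof.
move=> /qcomm_sym ac /qcomm_sym bc.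
by rewrite -[z + t]opprK opprD; apply/qcomm_sym/qcommM.
Qed.

Lemma qcomm_prod (I : eqType) (r : seq I) (f : I -> int) a (b : I -> A) :
  (forall i, i \in r -> qcomm (f i) a (b i)) ->
  qcomm (\sum_(i <- r) f i) a (\prod_(i <- r) b i).
Proof.
elim: r => [|i r IHr] ab; first by rewrite !big_nil /qcomm mul1r mulr1 mul1r.
rewrite !big_cons; apply: qcommM; first by apply: ab; rewrite mem_head.
by apply: IHr => l lr; apply: ab; rewrite inE lr orbT.
Qed.

End QCommutation.

Section Generators.

Variables (m n : nat) (A : unitRingType) (eps : A) (q : 'I_m -> 'Z_n -> A).
Hypotheses (n_ge3 : (3 <= n)%N) (rels : qtorus_relations eps q).

(** The power of [eps] gained when a generator of row [j] passes one of row
    [j'], in terms of the difference [d] of their levels, where the level of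
    [(j, i)] is the [k] such that it lies in [S_k].  Values of [d] other than
    1, -1 and 0 give commuting generators.  The formula needs 1, -1 and 0 to be
    distinct modulo [n]. *)
Definition qexp (j j' : 'I_m) (d : 'Z_n) : int :=
  if j == j' then (d == 1)%:Z - (d == -1)%:Z
  else (-1) ^+ (j' < j)%N * ((d == 1)%:Z + (d == -1)%:Z - 2 * (d == 0)%:Z).

Lemma Zn_neq : [/\ (1 == 0 :> 'Z_n) = false, (1 == -1 :> 'Z_n) = false
  & (-1 == 0 :> 'Z_n) = false].
Proof.
have: (2%:R == 0%:R :> 'Z_n) = false.
  by rewrite natZn_eq ?mod0n ?modn_small //; lia.
by rewrite oppr_eq0 oner_eq0 => <-; rewrite -[1 == -1]subr_eq0 opprK.
Qed.

Lemma inSE (k : 'Z_n) (j : 'I_m) i : inS k (j, i) = (i + j%:R == k).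
Proof. by rewrite /inS /= -natr1 addrA addrC (inj_eq (addrI _)). Qed.

Lemma gen_qcomm_adj (j : 'I_m) i (j' : 'I_m) i' : i + j%:R = i' + j'%:R + 1 ->
  qcomm eps (if (j <= j')%N then 1 else -1) (q j i) (q j' i').
Proof.
have [_ _ _ adj_le adj_gt _ _ _] := rels => e.
have [le|gt] := leqP j j'; rewrite /qcomm mulrA.
  by rewrite (adj_le (i' + j'%:R)) ?inSE ?e.
by rewrite (adj_gt (i' + j'%:R)) ?inSE ?e.
Qed.

Lemma gen_qcomm (j : 'I_m) i (j' : 'I_m) i' :
  qcomm eps (qexp j j' (i + j%:R - (i' + j'%:R))) (q j i) (q j' i').
Proof.
have [eps_u _ _ _ _ same_lt same_gt comm] := rels.
have [z10 z1N zN0] := Zn_neq.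
set d := _ - _; have kE : i + j%:R = i' + j'%:R + d by rewrite [RHS]addrC subrK.
clearbody d; rewrite /qexp -val_eqE /=.
have [d1|d1] := eqVneq d 1.
  rewrite d1 in kE; have := gen_qcomm_adj kE.
  by rewrite d1 z1N z10; case: ltngtP.
have [dN|dN] := eqVneq d (-1).
  have/gen_qcomm_adj/(qcomm_sym eps_u): i' + j'%:R = i + j%:R + 1.
    by rewrite kE dN addrNK.
  by rewrite dN zN0; case: ltngtP.
have [d0|d0] := eqVneq d 0; last first.
  rewrite [X in qcomm _ X](_ : _ = 0).
    rewrite /qcomm expr0z mul1r.
    have dE : d = i + j%:R - (i' + j'%:R) by rewrite kE addrC addKr.
    (* Two covered generators have levels differing by 1, -1 or 0. *)
    by apply: comm; apply/negP => /existsP[k]; rewrite !inSE;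
      (case/orP=> [/andP[/eqP e1 /eqP e2]|/and3P[/eqP e1 /eqP e2 _]];
       move: d1 dN d0; rewrite dE e1 e2 ?subrr ?eqxx //);
      rewrite ?opprD 1?addrA ?[k + 1 - k]addrAC ?subrr ?add0r ?eqxx.
  by case: ifP => // _; apply: mulr0.
rewrite /qcomm; case: ltngtP => [gt|lt|e] /=.
- by rewrite [LHS](same_gt (i + j%:R)) ?inSE ?kE ?d0 ?addr0 // -[LHS]mulrA.
- by rewrite [LHS](same_lt (i + j%:R)) ?inSE ?kE ?d0 ?addr0 // -[LHS]mulrA.
rewrite [X in eps ^ X](_ : _ = 0) // expr0z mul1r; have jj := val_inj e.
by move: kE; rewrite jj d0 addr0 => /addIr ->.
Qed.

End Generators.

(** * Products over a full cycle, and the kappa elements *)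

Section CyclicProducts.
Variables (m n : nat) (A : unitRingType) (eps : A) (q : 'I_m -> 'Z_n -> A).
Hypotheses (n_ge3 : (3 <= n)%N) (rels : qtorus_relations eps q).

Lemma nat_n0 : n%:R = 0 :> 'Z_n.
Proof.
by rewrite -[0]/(0%:R); apply/eqP; rewrite natZn_eq ?modnn ?mod0n //; lia.
Qed.

Lemma sum_natZn (F : 'Z_n -> int) : \sum_(0 <= a < n) F a%:R = \sum_x F x.
Proof.
case: n n_ge3 F => [|[|k]] // _ F; rewrite big_mkord.
by apply: eq_bigr => x _; rewrite natr_Zp.
Qed.

(** The exponents are 1, -1 within a row and 1, 1, -2 (or the opposite) between
    two rows. *)
Lemma qexp_sum (j j' : 'I_m) : \sum_x @qexp m n j j' x = 0.
Proof.
have sum1 (t : 'Z_n) : \sum_x ((x == t)%:Z) = 1.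
  by rewrite (bigD1 t) //= eqxx big1 ?addr0 // => x /negPf ->.
rewrite /qexp; case: (j == j').
  by rewrite big_split /= sumrN !sum1 subrr.
by rewrite -mulr_sumr big_split /= sumrN -mulr_sumr big_split /= !sum1 mulr0.
Qed.

(** When [i] runs over a full cycle the level difference takes each value
    exactly once, so the exponents cancel whatever the order of the factors,
    which [g] encodes. *)
Lemma full_prod_comm (f : nat -> 'Z_n) (g : 'Z_n -> 'Z_n) (j j' : 'I_m) i' :
  (forall a, f a = g a%:R) -> injective g ->
  GRing.comm (q j' i') (\prod_(0 <= a < n) q j (f a)).
Proof.
move=> fg gI.
have [eps_u eps_c _ _ _ _ _ _] := rels.
pose h x := i' + j'%:R - (g x + j%:R).
have hI : injective h by move=> x y /addrI/oppr_inj/addIr/gI.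
have: qcomm eps (\sum_(0 <= a < n) qexp j' j (h a%:R)) (q j' i')
    (\prod_(0 <= a < n) q j (f a)).
  by apply: qcomm_prod => // a _; rewrite /h -fg; apply: gen_qcomm.
rewrite (sum_natZn (fun x => qexp j' j (h x))).
by rewrite -(reindex_inj hI (P := xpredT) (F := qexp j' j)) qexp_sum /qcomm mul1r.
Qed.

(** The two products differ by moving [x (i + 1)] from one end to the other. *)
Lemma descprod_shift (x : 'Z_n -> A) i :
  x (i + 1) \is a GRing.unit ->
  GRing.comm (x (i + 1)) (\prod_(0 <= a < n) x (i - a%:R)) ->
  \prod_(0 <= a < n) x (i - a%:R) = \prod_(0 <= a < n) x (i + 1 - a%:R).
Proof.
move=> ux cx; apply: (mulIr ux); rewrite -{}cx.
have n_gt0 : (0 < n)%N by lia.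
have last_factor (F : nat -> A) :
    \prod_(0 <= a < n) F a = \prod_(0 <= a < n.-1) F a * F n.-1.
  by rewrite -{1}(prednK n_gt0) big_nat_recr.
have nE : - n.-1%:R = 1 :> 'Z_n.
  by apply/eqP; rewrite eq_sym -subr_eq0 opprK nat1r prednK // nat_n0.
rewrite last_factor [in RHS]big_ltn // subr0 nE -!mulrA; congr (_ * (_ * _)).
rewrite big_add1; apply: eq_bigr => a _.
by rewrite -natr1 opprD addrACA subrr addr0.
Qed.

(** Reversing the order of a product inside one row costs a power of [eps] that
    is the same for all rows, since the exchange rule within a row does not
    depend on the row.  This is needed because the images of rows [j] and [j+1]
    telescope in opposite orders. *)
Lemma row_prod_rev k : exists E : int, forall j,
  \prod_(0 <= a < k) q j a%:R = eps ^ E * \prod_(0 <= a < k) q j (k - a.+1)%:R.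
Proof.
have [eps_u eps_c _ _ _ _ _ _] := rels.
elim: k => [|k [E IHk]]; first by exists 0 => j; rewrite !big_geq // mul1r.
pose z (a : nat) : int :=
  (k%:R - a%:R == 1 :> 'Z_n)%:Z - (k%:R - a%:R == -1 :> 'Z_n)%:Z.
exists (- (\sum_(0 <= a < k) z a) + E) => j.
rewrite big_nat_recr //= [X in _ = _ * X]big_ltn // big_add1 /= subSS subn0.
have H : qcomm eps (\sum_(0 <= a < k) z a) (q j k%:R)
    (\prod_(0 <= a < k) q j a%:R).
  apply: qcomm_prod => // a _; have := gen_qcomm n_ge3 rels j k%:R j a%:R.
  by rewrite /qexp eqxx opprD addrACA subrr addr0.
have := qcomm_sym eps_u H; rewrite /qcomm => ->.
rewrite IHk (mulrA (q j _)) -(epsX_central eps_c) -(mulrA (eps ^ E)) mulrA.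
by rewrite -exprzDr.
Qed.

End CyclicProducts.

Lemma sum_nat_eqb c l u :
  \sum_(l <= a < u) ((a == c)%:Z) = (l <= c < u)%N%:Z :> int.
Proof.
rewrite (eq_bigr (fun a => if a == c then 1%:Z else 0)) => [|a _].
  by rewrite -big_mkcond /= big_nat1_eq; case: ifP.
by case: eqP.
Qed.

Section Kappa.
Variables (m n : nat) (A : unitRingType) (eps : A) (g : 'I_m -> 'Z_n -> A).
Hypotheses (n_ge3 : (3 <= n)%N) (rels : qtorus_relations eps g).
Variables (lo hi : 'I_m).
Hypothesis hi_lo : hi = lo.+1 :> nat.
Local Notation p := (g lo).
Local Notation q := (g hi).
Local Notation kap := (kappa p q).

(** The part common to the terms of [kap i] and [kap (i + 1)]: for [h < n - 1],
    [kmid h i * q i] is the term of index [h] of the former and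
    [p i * kmid h i] that of index [h + 1] of the latter. *)
Definition kmid h i :=
  \prod_(1 <= a < h.+1) p (i - a%:R) * \prod_(h.+2 <= a < n) q (i - a%:R).

(** Add up the exponents of [q i * p i] against each factor: the contributions
    come only from the factors with [a] among 1, 2, n-2 and n-1, and they cancel
    unless [h = n - 1]. *)
Lemma qp_kmid h i : (h < n)%N -> qcomm eps (h == n.-1)%:Z (q i * p i) (kmid h i).
Proof.
move=> hn.
have [eps_u eps_c _ _ _ _ _ _] := rels.
pose ep a : int := (a == 1%N)%:Z + (a == n.-1)%:Z - (a == n.-2)%:Z.
pose eq a : int := (a == 2)%:Z - (a == n.-1)%:Z.
have lohi : lo == hi = false by rewrite -val_eqE /= hi_lo; lia.
have hilo : hi == lo = false by rewrite eq_sym.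
have n1 : (1 < n)%N by lia.
have mn a c : (a <= n.+1)%N -> (c < 2)%N ->
    (a == c %[mod n])%N = (a == c) || (a == c + n)%N.
  move=> an c2; rewrite (modn_small (m := c)); last lia.
  case: (ltnP a n) => [an1|na]; first by rewrite modn_small //; lia.
  by rewrite -{1}(subnK na) modnDr modn_small; lia.
have e0 a : (a%:R == 0 :> 'Z_n) = (a == 0 %[mod n])%N by rewrite -natZn_eq.
have e1 a : (a%:R == 1 :> 'Z_n) = (a == 1 %[mod n])%N by rewrite -natZn_eq.
have eN a : (a%:R == -1 :> 'Z_n) = (a.+1 == 0 %[mod n])%N.
  by rewrite -subr_eq0 opprK natr1 -natZn_eq.
have cp a : (1 <= a < n)%N -> qcomm eps (ep a) (q i * p i) (p (i - a%:R)).
  move=> an; have := qcommMl eps_u eps_c (gen_qcomm n_ge3 rels hi i lo (i - a%:R))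
     (gen_qcomm n_ge3 rels lo i lo (i - a%:R)).
  have -> : i + hi%:R - (i - a%:R + lo%:R) = a.+1%:R.
    by rewrite hi_lo -!natr1; ring.
  have -> : i + lo%:R - (i - a%:R + lo%:R) = a%:R by ring.
  have -> : qexp hi lo (a.+1%:R : 'Z_n) = 2 * (a == n.-1)%:Z - (a == n.-2)%:Z.
    rewrite /qexp hilo eN e1 e0 !mn ?hi_lo ?ltnSn ?expr1; [|lia..].
    have -> : (a.+1 == 1)%N || (a.+1 == 1 + n)%N = false by lia.
    have -> : (a.+2 == 0)%N || (a.+2 == 0 + n)%N = (a == n.-2) by lia.
    have -> : (a.+1 == 0)%N || (a.+1 == 0 + n)%N = (a == n.-1) by lia.
    by rewrite /=; lia.
  have -> : qexp lo lo (a%:R : 'Z_n) = (a == 1%N)%:Z - (a == n.-1)%:Z.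
    rewrite /qexp eqxx e1 eN !mn; [|lia..].
    by congr (_%:Z - _%:Z); lia.
  by congr (qcomm eps _ _ _); rewrite /ep; lia.
have cq a : (2 <= a < n)%N -> qcomm eps (eq a) (q i * p i) (q (i - a%:R)).
  move=> an; have := qcommMl eps_u eps_c (gen_qcomm n_ge3 rels hi i hi (i - a%:R))
     (gen_qcomm n_ge3 rels lo i hi (i - a%:R)).
  have -> : i + hi%:R - (i - a%:R + hi%:R) = a%:R by ring.
  have -> : i + lo%:R - (i - a%:R + hi%:R) = a.-1%:R.
    by rewrite hi_lo -natr1 -[in a%:R](@prednK a); [rewrite -natr1; ring | lia].
  have -> : qexp hi hi (a%:R : 'Z_n) = - (a == n.-1)%:Z.
    rewrite /qexp eqxx e1 eN !mn; [|lia..].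
    have -> : (a == 1)%N || (a == 1 + n)%N = false by lia.
    have -> : (a.+1 == 0)%N || (a.+1 == 0 + n)%N = (a == n.-1) by lia.
    by rewrite /=; lia.
  have -> : qexp lo hi (a.-1%:R : 'Z_n) = (a == 2)%:Z.
    rewrite /qexp lohi eN e1 e0 !mn ?hi_lo; [|lia..].
    have -> : (a.-1 == 1)%N || (a.-1 == 1 + n)%N = (a == 2) by lia.
    have -> : (a.-1.+1 == 0)%N || (a.-1.+1 == 0 + n)%N = false by lia.
    have -> : (a.-1 == 0)%N || (a.-1 == 0 + n)%N = false by lia.
    by rewrite ltnNge leqnSn /=; lia.
  by congr (qcomm eps _ _ _); rewrite /eq; lia.
have -> : (h == n.-1)%:Z =
    \sum_(1 <= a < h.+1) ep a + \sum_(h.+2 <= a < n) eq a.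
  by rewrite /ep /eq !big_split /= !sumrN !sum_nat_eqb; lia.
by apply: qcommM => //; apply: qcomm_prod => // a; rewrite mem_index_iota => ha;
  [apply: cp | apply: cq]; lia.
Qed.

(** Descending, as the factors in kappa: the extreme terms of the telescoping
    sums below are full cycle products in this order. *)
Definition descprod (x : 'Z_n -> A) i := \prod_(0 <= a < n) x (i - a%:R).

Lemma descprod_comm j j' i i' : GRing.comm (g j' i') (descprod (g j) i).
Proof.
apply: (full_prod_comm n_ge3 rels (g := fun x => i - x)) => //.
by move=> x y /addrI/oppr_inj.
Qed.

Lemma gen_u j i : g j i \is a GRing.unit.
Proof. by case: rels. Qed.

(** The factor [g j i] commutes with its full cycle product, so it can be
    cancelled on the other side. *)
Lemma descprod_rot j i :
  g j i * \prod_(1 <= a < n) g j (i - a%:R) = descprod (g j) i /\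
  \prod_(1 <= a < n) g j (i - a%:R) * g j i = descprod (g j) i.
Proof.
have e : g j i * \prod_(1 <= a < n) g j (i - a%:R) = descprod (g j) i.
  by rewrite /descprod [RHS]big_ltn ?subr0 //; lia.
split=> //; apply: (mulrI (gen_u j i)).
by rewrite mulrA e descprod_comm.
Qed.

Lemma descprod_const j i : descprod (g j) i = descprod (g j) (i + 1).
Proof. by apply: descprod_shift => //; [apply: gen_u | apply: descprod_comm]. Qed.

Lemma kappa_cur i :
  kap i = \sum_(0 <= h < n.-1) kmid h i * q i + \prod_(1 <= a < n) p (i - a%:R).
Proof.
have n0 := nat_n0 n_ge3.
have last_term (F : nat -> A) :
    \sum_(0 <= a < n) F a = \sum_(0 <= a < n.-1) F a + F n.-1.
  by rewrite -{1}(@prednK n) ?big_nat_recr //; lia.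
rewrite /kappa last_term; congr (_ + _); last first.
  by rewrite (@prednK n) ?[X in _ * X]big_geq ?mulr1 //; lia.
apply: eq_big_nat => h hn; rewrite [X in _ * X = _]big_nat_recr /=; last lia.
by rewrite n0 subr0 mulrA.
Qed.

Lemma kappa_next i :
  kap (i + 1) =
    \prod_(1 <= a < n) q (i - a%:R) + \sum_(0 <= h < n.-1) p i * kmid h i.
Proof.
have sh (x : 'Z_n -> A) l u : \prod_(l.+1 <= a < u.+1) x (i + 1 - a%:R) =
    \prod_(l <= a < u) x (i - a%:R).
  rewrite big_add1; apply: eq_bigr => a _.
  by rewrite -natr1 opprD addrACA subrr addr0.
rewrite /kappa [LHS]big_ltn; last lia.
congr (_ + _); first by rewrite big_geq // mul1r sh.
rewrite big_add1; apply: eq_big_nat => h hn.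
by rewrite !sh big_ltn // subr0 mulrA.
Qed.

(** The terms [p i * kmid h i * q i] occur in both products and cancel; the two
    extreme terms are full cycle products. *)
Lemma kappa_left i : kap (i + 1) * q i - p i * kap i = descprod q i - descprod p i.
Proof.
have [cq1 cq2] := descprod_rot hi i; have [cp1 cp2] := descprod_rot lo i.
rewrite (kappa_cur i) kappa_next mulrDl mulrDr cq2 cp1 mulr_suml mulr_sumr.
under eq_bigr do rewrite -mulrA.
by rewrite opprD addrA addrK.
Qed.

(** The mirror image of [kappa_left]; here the intermediate terms cancel because
    [q i * p i] commutes with [kmid h i] for [h < n - 1]. *)
Lemma kappa_right i : q i * kap (i + 1) - kap i * p i = descprod q i - descprod p i.
Proof.
have [cq1 cq2] := descprod_rot hi i; have [cp1 cp2] := descprod_rot lo i.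
rewrite (kappa_cur i) kappa_next mulrDl mulrDr cq1 cp2 mulr_suml mulr_sumr.
suff -> : \sum_(0 <= h < n.-1) q i * (p i * kmid h i)
        = \sum_(0 <= h < n.-1) kmid h i * q i * p i.
  by rewrite opprD addrA addrK.
apply: eq_big_nat => h hn; rewrite mulrA qp_kmid //; last lia.
by rewrite ltn_eqF ?mul1r ?mulrA //; lia.
Qed.

Lemma pq_comm i : p i * q i = eps * (q i * p i).
Proof.
have [eps_u _ _ _ _ _ _ _] := rels.
have e : i + hi%:R = i + lo%:R + 1 by rewrite hi_lo -natr1 addrA.
have := qcomm_sym eps_u (gen_qcomm_adj rels e).
by rewrite hi_lo ltnn opprK /qcomm expr1z.
Qed.

(** In the terms of index [h < n - 1] the power of [eps] comes from
    the last factor [q i], in the last term from [qp_kmid]. *)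
Lemma kappa_qp i : q i * p i * kap i = eps * (kap i * (q i * p i)).
Proof.
have [eps_u eps_c _ _ _ _ _ _] := rels.
rewrite (kappa_cur i) mulrDr mulrDl mulrDr mulr_sumr mulr_suml mulr_sumr.
congr (_ + _).
  apply: eq_big_nat => h hn; rewrite mulrA qp_kmid //; last lia.
  rewrite ltn_eqF ?mul1r; last lia.
  move: (kmid h i) => w; rewrite -!mulrA.
  rewrite pq_comm (mulrA (q i) eps) -(eps_c (q i)) -(mulrA eps).
  by rewrite (mulrA w) -(eps_c w) -!mulrA.
have n_gt0 : (0 < n)%N by lia.
have kmid_last : kmid n.-1 i = \prod_(1 <= a < n) p (i - a%:R).
  by rewrite /kmid (@prednK n) // [X in _ * X]big_geq ?mulr1.
rewrite -kmid_last qp_kmid ?eqxx ?expr1z //; lia.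
Qed.

Section Image.

Variables p' q' : 'Z_n -> A.
Hypothesis kap_u : forall i, kap i \is a GRing.unit.
Hypothesis p'E : forall i, p' i = (kap i)^-1 * q i * kap (i + 1).
Hypothesis q'E : forall i, q' i = (kap (i + 1))^-1 * p i * kap i.

Lemma image_mul i : p' i * q' i = p i * q i.
Proof.
have [eps_u eps_c _ _ _ _ _ _] := rels.
rewrite p'E q'E -!mulrA mulVKr // [q i * _]mulrA kappa_qp mulrA -eps_c.
by rewrite -mulrA mulKr // pq_comm.
Qed.

(** By [kappa_left] and [kappa_right], the images are [q i] and [p (i + 1)]
    shifted by opposite amounts. *)
Lemma image_add i : p' (i + 1) + q' i = p (i + 1) + q i.
Proof.
have -> : q' i = q i - (kap (i + 1))^-1 * (descprod q i - descprod p i).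
  rewrite -kappa_left mulrBr mulKr // opprB addrCA subrr addr0.
  by rewrite q'E mulrA.
have -> : p' (i + 1) = p (i + 1) + (kap (i + 1))^-1 * (descprod q i - descprod p i).
  rewrite !(descprod_const _ i) -kappa_right mulrBr mulKr // addrCA subrr addr0.
  by rewrite p'E mulrA.
by rewrite addrACA subrr addr0.
Qed.

End Image.
End Kappa.

(** * The quantum skew field: morphisms, centre, cycle products *)

Section Conj.
Variables (K : unitRingType) (u : K) (u_unit : u \is a GRing.unit).

(** Conjugation is made a ring morphism so that centrality can be read off the
    generators by [qskew_morph_eq]; the proof of invertibility is an argument
    because the structure depends on it. *)
Definition conj_by of u \is a GRing.unit := fun x : K => u * x * u^-1.

Fact conj_by_additive : zmod_morphism (conj_by u_unit).
Proof. by move=> x y; rewrite /conj_by mulrBr mulrBl. Qed.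

Fact conj_by_multiplicative : monoid_morphism (conj_by u_unit).
Proof.
split=> [|x y]; first by rewrite /conj_by mulr1 mulrV.
by rewrite /conj_by -!mulrA mulKr // !mulrA.
Qed.

HB.instance Definition _ :=
  GRing.isZmodMorphism.Build K K (conj_by u_unit) conj_by_additive.
HB.instance Definition _ :=
  GRing.isMonoidMorphism.Build K K (conj_by u_unit) conj_by_multiplicative.

End Conj.

Section QSkewField.
Variables (m n : nat).

Lemma map_relations (A B : unitRingType) (f : {rmorphism A -> B}) (eps : A)
    (q : 'I_m -> 'Z_n -> A) :
  (forall b, f eps * b = b * f eps) -> qtorus_relations eps q ->
  qtorus_relations (f eps) (fun j i => f (q j i)).
Proof.
move=> fc [eu _ qu al ag sl sg co]; split=> //.
- exact: rmorph_unit.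
- by move=> j i; apply: rmorph_unit.
- by move=> k j i j' i' h1 h2 h3; rewrite -!rmorphM (al k).
- by move=> k j i j' i' h1 h2 h3; rewrite -rmorphM (ag k) // !rmorphM rmorphV.
- move=> k j i j' i' h1 h2 h3.
  by rewrite -rmorphM (sl k) // !rmorphM rmorphV ?unitrX // rmorphXn.
- by move=> k j i j' i' h1 h2 h3; rewrite -rmorphM (sg k) // !rmorphM.
by move=> j i j' i' h1 h2; rewrite -!rmorphM co.
Qed.

Variables (K : unitRingType) (eps : K) (q : 'I_m -> 'Z_n -> K).
Hypothesis Kq : is_qskew_field eps q.

Lemma qskew_skew : is_skew_field K.
Proof. by have [A [eA [qA [io [_ []]]]]] := Kq. Qed.

(** The quantum torus has [eps] central, and every element of [K] is a fraction
    of two elements of the torus. *)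
Lemma eps_central_K a : eps * a = a * eps.
Proof.
have [A [eA [qA [io [[rA _] [skew inj frac] ioe ioq]]]]] := Kq.
have [eu eC _ _ _ _ _ _] := rA.
have cA b : GRing.comm (io eA) (io b) by rewrite /GRing.comm -!rmorphM eC.
have [x [y [y0 ->]]] := frac a; rewrite -ioe.
by apply: commrM => //; apply: commrV.
Qed.

Lemma qskew_relations : qtorus_relations eps q.
Proof.
have eC := eps_central_K.
have [A [eA [qA [io [[rA _] [skew inj frac] ioe ioq]]]]] := Kq.
have := @map_relations _ _ io eA qA; rewrite ioe => /(_ eC rA).
case=> ? ? qu al ag sl sg co; split=> //; move=> *; rewrite -!ioq; eauto.
Qed.

(** Both morphisms restrict to the torus, where the universal property applied
    to the common images of the generators makes them equal, and a morphism is
    determined on fractions.  Fixing [eps] ensures that its image is central, as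
    the universal property requires. *)
Lemma qskew_morph_eq (f g : {rmorphism K -> K}) :
  f eps = eps -> g eps = eps -> (forall j i, f (q j i) = g (q j i)) -> f =1 g.
Proof.
move=> fe ge fg.
have [A [eA [qA [io [[rA univ] [skew inj frac] ioe ioq]]]]] := Kq.
have rK : qtorus_relations eps (fun j i => g (io (qA j i))).
  rewrite -ge -{1}ioe; apply: (map_relations (f := g \o io)) => // b.
  by rewrite /= ioe ge eps_central_K.
have [h [_ _ hu]] := univ _ _ _ rK.
have gh := hu (g \o io) (etrans (congr1 g ioe) ge) (fun _ _ => erefl).
have fh : f \o io =1 h.
  by apply: hu => [|j i] /=; rewrite ?ioe // ioq fg -ioq.
have fgA b : f (io b) = g (io b) by exact: etrans (fh b) (esym (gh b)).
move=> x; have [a [b [b0 ->]]] := frac x.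
have ub : io b \is a GRing.unit.
  by apply: skew; apply: contra_neq b0 => e; apply: inj; rewrite e rmorph0.
by rewrite !rmorphM !rmorphV // !fgA.
Qed.

Lemma qskew_central u : u \is a GRing.unit ->
  (forall j i, GRing.comm (q j i) u) -> forall x, u * x = x * u.
Proof.
move=> uu uq x.
have: conj_by uu =1 idfun.
  apply: qskew_morph_eq => //=; first by rewrite /conj_by -eps_central_K mulrK.
  by move=> j i; rewrite /conj_by -uq mulrK.
by move=> /(_ x) /= e; rewrite -{2}e /conj_by mulrVK.
Qed.

Hypothesis n_ge3 : (3 <= n)%N.

(** Ascending, as in the kernel vector of a difference operator. *)
Definition ascprod (f : 'Z_n -> K) : K := \prod_(0 <= a < n) f a%:R.

Lemma ascprod_unit j : ascprod (q j) \is a GRing.unit.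
Proof.
have [_ _ qu _ _ _ _ _] := qskew_relations.
by apply: rpred_prod => a _; apply: qu.
Qed.

Lemma ascprod_central j x : ascprod (q j) * x = x * ascprod (q j).
Proof.
apply: qskew_central; first exact: ascprod_unit.
move=> j' i.
by apply: (full_prod_comm n_ge3 qskew_relations (g := id)) => [|? ?].
Qed.

(** Specialize [eps] to 1 and the generators to rational numbers, those of row
    [j] to 2 and the others to 1: the product of row [j] becomes [2 ^ n], the
    others become 1. *)
Lemma ascprod_inj : injective (fun j => ascprod (q j)).
Proof.
move=> j j' e; apply/eqP/negPn/negP => jj.
have [A [eA [qA [io [[rA univ] [skew inj frac] ioe ioq]]]]] := Kq.
pose q' (i : 'I_m) (k : 'Z_n) : rat := if i == j then 2 else 1.
have rQ : qtorus_relations (1 : rat) q'.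
  split=> //; try (by move=> *; rewrite ?expr1n ?invr1 ?mul1r mulrC).
  - by move=> a; rewrite mulrC.
  - by move=> i k; rewrite /q'; case: ifP.
have [h [_ hq _]] := univ _ _ _ rQ.
have eA' : \prod_(0 <= a < n) qA j a%:R = \prod_(0 <= a < n) qA j' a%:R.
  apply: inj; rewrite !rmorph_prod; under eq_bigr do rewrite ioq.
  by under [RHS]eq_bigr do rewrite ioq.
have := congr1 h eA'; rewrite !rmorph_prod.
under eq_bigr do rewrite hq.
under [RHS]eq_bigr do rewrite hq.
rewrite /q' eqxx eq_sym (negPf jj) !prodr_const_nat subn0 expr1n => /eqP.
by rewrite Num.Theory.pexprn_eq1 //= => /orP[/eqP n0|//]; lia.
Qed.

End QSkewField.

(** * Telescoping products *)

Section Telescope.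
Variables (K : unitRingType) (kap x y : nat -> K).
Hypothesis kap_u : forall i, kap i \is a GRing.unit.

Lemma telescope_inc k : (forall i, y i = (kap i)^-1 * x i * kap i.+1) ->
  \prod_(0 <= a < k) y a = (kap 0%N)^-1 * \prod_(0 <= a < k) x a * kap k.
Proof.
move=> yE; elim: k => [|k IHk]; first by rewrite !big_geq // mulr1 mulVr.
by rewrite !big_nat_recr //= IHk yE !mulrA mulrK.
Qed.

Lemma telescope_dec k : (forall i, y i = (kap i.+1)^-1 * x i * kap i) ->
  \prod_(0 <= a < k) y (k - a.+1)%N =
    (kap k)^-1 * \prod_(0 <= a < k) x (k - a.+1)%N * kap 0%N.
Proof.
move=> yE; elim: k => [|k IHk]; first by rewrite !big_geq // mulr1 mulVr.
rewrite !(@big_ltn _ _ _ 0) // !big_add1 /= !subSS !subn0.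
by rewrite IHk yE !mulrA mulrK.
Qed.

End Telescope.

(** * Words in the adjacent transpositions *)

Section AdjacentTranspositions.
Variable m : nat.

Definition word_perm (w : seq 'I_m.-1) : 'S_m :=
  (\prod_(j <- w) tperm (ord_lo j) (ord_hi j))%g.

(** Every permutation is a product of transpositions, and an adjacent
    transposition conjugates the transposition of two indices into that of two
    closer ones. *)
Lemma word_perm_surj u : exists w, word_perm w == u.
Proof.
have W1 : exists w, word_perm w == 1%g by exists [::]; rewrite /word_perm big_nil.
have WM s t : (exists w, word_perm w == s) -> (exists w, word_perm w == t) ->
    exists w, word_perm w == (s * t)%g.
  move=> [w /eqP <-] [w' /eqP <-]; exists (w ++ w').
  by rewrite /word_perm big_cat.
have Wadj (i j : 'I_m) : j = i.+1 :> nat -> exists w, word_perm w == tperm i j.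
  move=> ji; have im : (i < m.-1)%N by have := ltn_ord j; lia.
  exists [:: Ordinal im]; rewrite /word_perm big_seq1.
  by apply/eqP; congr tperm; apply: val_inj.
have Wlt d (i j : 'I_m) : (j - i = d.+1)%N -> exists w, word_perm w == tperm i j.
  elim: d i j => [|d IHd] i j dE; first by apply: Wadj; lia.
  have km : (j.-1 < m)%N by have := ltn_ord j; lia.
  pose k := Ordinal km.
  have <- : (tperm k j * (tperm i k * tperm k j))%g = tperm i j.
    rewrite -{1}[tperm k j]tpermV -/(conjg _ _) tpermJ tpermL tpermD //.
      by rewrite -val_eqE /=; lia.
    by rewrite -val_eqE /=; lia.
  have kj : exists w, word_perm w == tperm k j by apply: Wadj; rewrite /=; lia.
  by apply: (WM) => //; apply: (WM) => //; apply: IHd; rewrite /=; lia.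
have [ts -> _] := prod_tpermP u.
elim/big_ind: _ => // -[i j] _ /=.
have [ij|ji|/val_inj ->] := ltngtP i j; last by rewrite tperm1.
  by apply: (Wlt (j - i).-1); lia.
by rewrite tpermC; apply: (Wlt (i - j).-1); lia.
Qed.

Lemma enum_lo_hi (j : 'I_m.-1) :
  exists s1 s2, enum 'I_m = s1 ++ ord_lo j :: ord_hi j :: s2.
Proof.
exists (take j (enum 'I_m)), (drop j.+2 (enum 'I_m)).
rewrite -{1}(cat_take_drop j (enum 'I_m)); congr (_ ++ _).
have hm : (j.+1 < m)%N by have := ltn_ord j; lia.
rewrite (drop_nth (ord_lo j)) ?size_enum_ord; last lia.
rewrite (drop_nth (ord_lo j) (n := j.+1)) ?size_enum_ord //.
by congr [:: _, _ & _]; apply: val_inj; rewrite /= nth_enum_ord //; lia.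
Qed.

End AdjacentTranspositions.

Lemma tperm_braid (T : finType) (a b c : T) : a != b -> b != c -> a != c ->
  (tperm a b * (tperm b c * tperm a b) = tperm b c * (tperm a b * tperm b c))%g.
Proof.
move=> ab bc ac.
rewrite -{1}[tperm a b]tpermV -{2}[tperm b c]tpermV -!/(conjg _ _) !tpermJ.
by rewrite tpermR tpermL !tpermD // eq_sym.
Qed.

Lemma tperm_comm (T : finType) (a b c d : T) :
  a != c -> a != d -> b != c -> b != d ->
  (tperm a b * tperm c d = tperm c d * tperm a b)%g.
Proof. by move=> ac ad bc bd; rewrite conjgC tpermJ !tpermD // eq_sym. Qed.

(** * Morphisms attached to words *)

Section Words.

Variables (n m : nat) (n_ge3 : (3 <= n)%N) (K : unitRingType) (eps : K).
Variables (q : 'I_m -> 'Z_n -> K) (Kq : is_qskew_field eps q).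
Variables (R : 'I_m.-1 -> {rmorphism K -> K}).
Hypothesis R_def : forall j : 'I_m.-1, is_geometric_R eps q j (R j).

Local Notation kap j := (kappa (q (ord_lo j)) (q (ord_hi j))).
Local Notation s_ j := (tperm (ord_lo j) (ord_hi j)).

Let rels := qskew_relations Kq.

(** Were kappa zero, so would be its inverse and the image of the unit [p_i],
    but a ring morphism preserves units. *)
Lemma kappa_unit j i : kap j i \is a GRing.unit.
Proof.
apply: (qskew_skew Kq); apply/eqP => k0.
have [_ Rp _ _] := R_def j.
have [_ _ qu _ _ _ _ _] := rels.
have := rmorph_unit (R j) (qu (ord_lo j) i).
by rewrite Rp k0 invr0 !mul0r unitr0.
Qed.

(** The image of row [j] telescopes in ascending order and that of row [j+1] in
    descending order; the remaining outer factors conjugate a central element. *)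
Lemma R_ascprod j k : R j (ascprod (q k)) = ascprod (q (s_ j k)).
Proof.
have [Re Rp Rq Rfix] := R_def j.
have [eps_u eps_c _ _ _ _ _ _] := rels.
have ku i : kap j i%:R \is a GRing.unit by apply: kappa_unit.
have n0 : n%:R = 0%:R :> 'Z_n by apply: nat_n0.
rewrite {1}/ascprod.
case: tpermP => [->|->|/eqP/negPf lo /eqP/negPf hi].
- rewrite rmorph_prod.
  rewrite (telescope_inc (kap := fun i => kap j i%:R)
    (x := fun i => q (ord_hi j) i%:R)) //.
    rewrite n0 -/(ascprod (q (ord_hi j))) -mulrA.
    by rewrite (ascprod_central Kq n_ge3) mulKr.
  by move=> i; rewrite Rp natr1.
- have [E incE] := row_prod_rev n_ge3 rels n.
  have epsE : R j (eps ^ E) = eps ^ E by rewrite rmorphXz ?Re.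
  rewrite incE rmorphM epsE rmorph_prod.
  rewrite (telescope_dec (kap := fun i => kap j i%:R)
    (x := fun i => q (ord_lo j) i%:R)
    (y := fun i => R j (q (ord_hi j) i%:R))) //.
    rewrite n0 -[_ * _ * kap j _]mulrA mulrA epsX_central // -mulrA.
    rewrite [eps ^ E * _]mulrA -incE.
    by rewrite -/(ascprod (q (ord_lo j))) (ascprod_central Kq n_ge3) mulKr.
  by move=> i; rewrite Rq natr1.
by rewrite rmorph_prod; apply: eq_bigr => a _; rewrite Rfix // ?lo ?hi.
Qed.

Definition gens (f : K -> K) (j : 'I_m) (k : nat) : K := f (q j k%:R).

(** The morphism [f] is arbitrary so that the invariance can be iterated along a
    word: the identities behind it are equalities in [K], which [f] transports. *)
Lemma diffops_R (f : {rmorphism K -> K}) j g :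
  diffops (gens (f \o R j)) (enum 'I_m) g =1 diffops (gens f) (enum 'I_m) g.
Proof.
have [s1 [s2 sE]] := enum_lo_hi j.
have := enum_uniq 'I_m; rewrite sE cat_uniq /= !inE.
case/and3P=> _ /norP[lo1 /norP[hi1 _]] /and3P[/norP[_ lo2] hi2 _].
have [Re Rp Rq Rfix] := R_def j.
have other i : i != ord_lo j -> i != ord_hi j -> gens (f \o R j) i =1 gens f i.
  by move=> il ih k; rewrite /gens /= Rfix.
have oth (s : seq 'I_m) : ord_lo j \notin s -> ord_hi j \notin s ->
  forall i, i \in s -> gens (f \o R j) i =1 gens f i.
  move=> ls hs i si; apply: other; first by apply: contraNneq ls => <-.
  by apply: contraNneq hs => <-.
move=> k; rewrite /diffops !foldl_cat /= -!/(diffops _ _ _).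
rewrite (eq_in_diffops _ (oth s2 lo2 hi2)).
apply: eq_diffops; set h1 := diffops _ _ _; set h2 := diffops _ _ _.
have h12 : h1 =1 h2 by apply: eq_in_diffops; apply: oth.
move=> l; rewrite (eq_diffop _ (eq_diffop _ h12)).
have kl : val (ord_hi j) = (ord_lo j).+1 by [].
have ku := kappa_unit j.
apply: diffop_pair => a; rewrite /gens /=.
  rewrite -[LHS]rmorphM -[RHS]rmorphM; congr (f _).
  exact: (image_mul n_ge3 rels kl ku Rp Rq).
rewrite -[LHS]rmorphD -[RHS]rmorphD -natr1; congr (f _).
exact: (image_add n_ge3 rels kl ku Rp Rq).
Qed.

(** The first letter acts first, which agrees with the convention that a product
    of permutations applies its left factor first. *)
Fixpoint word_morph (w : seq 'I_m.-1) : {rmorphism K -> K} :=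
  if w is j :: w' then (word_morph w' \o R j : {rmorphism K -> K})
  else (idfun : {rmorphism K -> K}).

Lemma word_morph_cat w1 w2 x :
  word_morph (w1 ++ w2) x = word_morph w2 (word_morph w1 x).
Proof. by elim: w1 x => //= j w1 IH x; rewrite IH. Qed.

Lemma word_morph_eps w : word_morph w eps = eps.
Proof. by elim: w => //= j w IH; have [-> _ _ _] := R_def j. Qed.

Lemma word_morph_ascprod w k :
  word_morph w (ascprod (q k)) = ascprod (q (word_perm w k)).
Proof.
elim: w k => [|j w IH] k; first by rewrite /word_perm big_nil perm1.
by rewrite /= R_ascprod IH /word_perm big_cons permM.
Qed.

Lemma word_diffops w g :
  diffops (gens (word_morph w)) (enum 'I_m) g
    =1 diffops (gens idfun) (enum 'I_m) g.
Proof. by elim: w => //= j w IH k; rewrite diffops_R. Qed.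

(** Both words send the generators to factorizations of the same operator, with
    the same central cycle products in the same order. *)
Lemma word_morph_eq w w' : word_perm w = word_perm w' ->
  word_morph w =1 word_morph w'.
Proof.
move=> ww; apply: (qskew_morph_eq Kq); rewrite ?word_morph_eps //.
have [_ _ qu _ _ _ _ _] := rels.
have per (f : K -> K) j : quasiperiodic n 1 (gens f j).
  by move=> k; rewrite /gens natrD (nat_n0 n_ge3) addr0 mul1r.
have ascprodE v j : \prod_(0 <= i < n) gens (word_morph v) j i =
    ascprod (q (word_perm v j)).
  by rewrite -word_morph_ascprod rmorph_prod.
have := factorization_unique (qskew_skew Kq) (n := n)
  (x := gens (word_morph w)) (y := gens (word_morph w'))
  (lam := fun j => ascprod (q (word_perm w j))) (s := enum 'I_m).
move=> /(_ (per _) (per _)) H j i.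
have -> : i = (i : nat)%:R.
  by case: (n) n_ge3 i => [|[|k]] // _ i; rewrite natr_Zp.
apply: H; rewrite ?enum_uniq ?mem_enum //.
- by move=> l k; apply: rmorph_unit.
- by move=> l a; apply: (ascprod_central Kq n_ge3).
- by move=> l l' /(ascprod_inj Kq n_ge3)/perm_inj.
- by move=> l; rewrite ascprodE ww.
by move=> g k; rewrite !word_diffops.
Qed.

End Words.

(** * The symmetric group action *)

Theorem theorem5p3 (n m : nat) (n_ge3 : (3 <= n)%N) (m_ge2 : (2 <= m)%N)
    (K : unitRingType) (eps : K) (q : 'I_m -> 'Z_n -> K)
    (Kq : is_qskew_field eps q)
    (R : 'I_m.-1 -> {rmorphism K -> K})
    (R_def : forall j : 'I_m.-1, is_geometric_R eps q j (R j)) :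
  [/\ forall j j' : 'I_m.-1, j' = j.+1 :> nat ->
        R j \o R j' \o R j =1 R j' \o R j \o R j',
      forall j : 'I_m.-1, R j \o R j =1 id,
      forall i j : 'I_m.-1, 1 < `|(i : nat)%:Z - (j : nat)%:Z| ->
        R i \o R j =1 R j \o R i
    & exists to : {action 'S_m &-> K},
        (forall s : 'S_m, exists f : {rmorphism K -> K},
           forall x, to x s = f x) /\
        (forall (j : 'I_m.-1) (x : K),
           to x (tperm (ord_lo j) (ord_hi j)) = R j x)].
Proof.
have wordE := word_morph_eq n_ge3 Kq R_def.
split.
- move=> j j' jj x; have /= := wordE [:: j; j'; j] [:: j'; j; j'] _ x.
  apply; rewrite /word_perm !big_cons !big_nil !mulg1.
  have -> : ord_lo j' = ord_hi j by apply: val_inj; rewrite /= jj.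
  by apply: tperm_braid; rewrite -val_eqE /= ?jj; lia.
- move=> j x; have /= := wordE [:: j; j] [::] _ x; apply.
  by rewrite /word_perm !big_cons !big_nil mulg1 tperm2.
- move=> i j ij x; have /= := wordE [:: j; i] [:: i; j] _ x; apply.
  rewrite /word_perm !big_cons !big_nil !mulg1.
  by apply: tperm_comm; rewrite -val_eqE /=; lia.
(* By [wordE] the choice of the word is immaterial, so that concatenating the
   chosen words is as good as choosing a word for the product. *)
pose w (s : 'S_m) := xchoose (word_perm_surj s).
have wP (s : 'S_m) : word_perm (w s) = s.
  by apply/eqP; apply: (xchooseP (word_perm_surj s)).
pose to x (s : 'S_m) := word_morph R (w s) x.
have to1 : to^~ 1%g =1 id.
  by move=> x; apply: (wordE _ [::]); rewrite wP /word_perm big_nil.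
have toM x : act_morph to x.
  move=> s t; rewrite /to -word_morph_cat; apply: wordE.
  by rewrite wP /word_perm big_cat -!/(word_perm _) !wP.
exists (TotalAction to1 toM); split=> [s|j x]; first by exists (word_morph R (w s)).
by rewrite /= /to (wordE _ [:: j]) // wP /word_perm big_seq1.
Qed.
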